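(* Let $(u,\beta)$ be a solution to double-obstacle Allen--Cahn (AC) flow on $[0,\infty)$. Then $u$ is globally Lipschitz, i.e. $u\in C^{0,1}([0,\infty);\mathcal V)$.
   Context: Let $G=(V,E)$ be a finite, undirected, simple, connected graph with symmetric weights $\omega_{ij}=\omega_{ji}$, $\omega_{ij}>0$ for $ij\in E$ and $\omega_{ij}=0$ for $ij\notin E$. Let $d_i=\sum_{j}\omega_{ij}>0$ be the degree of $i\in V$. Fix $r\in[0,1]$ and $\varepsilon>0$. Let $\mathcal V=\{u:V\to\mathbb R\}$ and, for $X\subseteq\mathbb R$, $\mathcal V_X=\{u:V\to X\}$; $\mathcal V$ carries the inner product $\langle u,v\rangle_{\mathcal V}=\sum_{i\in V}u_iv_id_i^r$ with norm $\|\cdot\|_{\mathcal V}$. $\mathbf 1\in\mathcal V$ is the constant function $1$. The graph Laplacian is $(\Delta u)_i=d_i^{-r}\sum_{j\in V}\omega_{ij}(u_i-u_j)$. For an open interval $T$, $H^1(T;\mathcal V)$ is the set of $u\in L^2(T;\mathcal V)$ with generalised (weak) time derivative $du/dt\in L^2(T;\mathcal V)$. For any interval $T$, $H^1_{loc}(T;\mathcal V)$ is the set of $u:T\to\mathcal V$ with $u\in H^1((a,b);\mathcal V)$ for all $a,b\in T$ with $a<b$. For $u\in\mathcal V_{[0,1]}$, $\mathcal B(u)$ is the set of $\alpha\in\mathcal V$ such that for each $i\in V$: $\alpha_i\ge0$ if $u_i=0$, $\alpha_i=0$ if $0<u_i<1$, and $\alpha_i\le0$ if $u_i=1$. A pair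 $(u,\beta)$ with $u:T\to\mathcal V_{[0,1]}$, $\beta:T\to\mathcal V$ is a solution to double-obstacle AC flow on an interval $T$ if $u\in H^1_{loc}(T;\mathcal V)\cap C^0(T;\mathcal V)$ and for a.e. $t\in T$, $\varepsilon\frac{du}{dt}+\varepsilon\Delta u(t)+\frac12\mathbf 1-u(t)=\beta(t)$ and $\beta(t)\in\mathcal B(u(t))$. *)

(* Defs.v *)
From HB Require Import structures.
From mathcomp Require Import all_boot all_order all_algebra.
From mathcomp Require Import all_classical all_reals all_analysis.

Set Implicit Arguments.
Unset Strict Implicit.
Unset Printing Implicit Defensive.

Import Order.TTheory GRing.Theory Num.Theory.
Import numFieldNormedType.Exports.

Local Open Scope classical_set_scope.
Local Open Scope ring_scope.

Record weighted_graph (R : realType) (V : finType) := WeightedGraph {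
  edge : rel V;
  edge_sym : symmetric edge;
  edge_irr : irreflexive edge;
  edge_connected : forall i j, connect edge i j;
  weight : V -> V -> R;
  weight_sym : forall i j, weight i j = weight j i;
  weight_gt0 : forall i j, edge i j -> 0 < weight i j;
  weight_eq0 : forall i j, ~~ edge i j -> weight i j = 0;
  degree_gt0 : forall i, 0 < \sum_j weight i j
}.

Section Graph.
Context {R : realType} {V : finType} (G : weighted_graph R V) (r : R).
Implicit Types (u v : {ffun V -> R}) (X : set R).

Definition degree (i : V) : R := \sum_j weight G i j.

Definition innerV u v : R := \sum_i u i * v i * degree i `^ r.

Definition normV u : R := Num.sqrt (innerV u u).

Definition valued_in X u : Prop := forall i, X (u i).

Definition oneV : {ffun V -> R} := [ffun=> 1].

Definition laplacian u : {ffun V -> R} :=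
  [ffun i => degree i `^ (- r) * \sum_j weight G i j * (u i - u j)].

Definition obstacle_subdiff u : set {ffun V -> R} :=
  [set alpha | forall i,
    [/\ u i = 0 -> 0 <= alpha i,
        0 < u i < 1 -> alpha i = 0
      & u i = 1 -> alpha i <= 0]].

End Graph.

(* Curves are total functions on R; only their values on the interval T
   matter. *)
Section Curves.
Context {R : realType} {V : finType} (G : weighted_graph R V) (r : R).
Implicit Types (T : interval R) (u v phi : R -> {ffun V -> R}).

Local Notation mu := (@lebesgue_measure R).

Definition continuousV T u : Prop :=
  forall t, t \in T ->
    normV G r (u s - u t) @[s --> within [set` T] (nbhs t)] --> (0 : R).

Definition L2 T u : Prop :=
  (forall i, measurable_fun [set` T] (fun t => u t i)) /\
  (\int[mu]_(t in [set` T]) ((normV G r (u t)) ^+ 2)%:E < +oo)%E.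

Definition derivV u (t : R) : {ffun V -> R} :=
  [ffun i => derive1 (fun s => u s i) t].

(* C_c^\infty(T; V), for T an open interval. *)
Definition test_function T phi : Prop :=
  (forall (n : nat) i t, derivable (derive1n n (fun s => phi s i)) t 1) /\
  exists2 K : set R, compact K /\ K `<=` [set` T]
                   & forall t, ~ K t -> phi t = 0.

Definition weak_derivative T u v : Prop :=
  forall phi, test_function T phi ->
    \int[mu]_(t in [set` T]) innerV G r (u t) (derivV phi t) =
    - \int[mu]_(t in [set` T]) innerV G r (v t) (phi t).

Definition H1 T u : Prop :=
  L2 T u /\ exists2 v, L2 T v & weak_derivative T u v.

Definition H1loc T u : Prop :=
  forall a b, a \in T -> b \in T -> a < b -> H1 `]a, b[ u.

(* v represents the class du/dt of some u in H1loc T; such a v is unique up to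
   equality almost everywhere on T. *)
Definition weak_derivative_loc T u v : Prop :=
  forall a b, a \in T -> b \in T -> a < b ->
    L2 `]a, b[ v /\ weak_derivative `]a, b[ u v.

Definition double_obstacle_AC_solution (eps : R) T u (beta : R -> {ffun V -> R})
    : Prop :=
  [/\ forall t, t \in T -> valued_in `[0, 1] (u t),
      H1loc T u,
      continuousV T u
    & exists2 du, weak_derivative_loc T u du
      & {ae mu, forall t, t \in T ->
          eps *: du t + eps *: laplacian G r (u t) + 2^-1 *: oneV - u t
            = beta t /\
          obstacle_subdiff (u t) (beta t)}].

Definition lipschitzV T u : Prop :=
  exists L : R, forall s t, s \in T -> t \in T ->
    normV G r (u s - u t) <= L * `|s - t|.

End Curves.

(* Main.v *)
Require Import Defs.
From HB Require Import structures.
From mathcomp Require Import all_boot all_order all_algebra.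
From mathcomp Require Import all_classical all_reals all_analysis.
From mathcomp Require Import ring lra.

Set Implicit Arguments.
Unset Strict Implicit.
Unset Printing Implicit Defensive.

Import Order.TTheory GRing.Theory Num.Theory.
Import numFieldNormedType.Exports.

Local Open Scope classical_set_scope.
Local Open Scope ring_scope.

(** The obstacles bound the speed of each component on one side everywhere and
    on both sides off the obstacles. Since the multiplier beta is nonpositive
    where [u i > 0] and nonnegative where [u i < 1], the equation gives, almost
    everywhere and with a constant C depending only on the graph, r and eps,

      du i / dt <= C  where [u i > 0],   du i / dt >= - C  where [u i < 1]

    ([obstacle_speed]); the Laplacian is bounded because u takes values in
    [0, 1]. To bound [u i t - u i s] from above, start from the last time p in
    [s, t] at which [u i] vanishes, or from p = s if there is none. In both
    cases [u i p <= u i s], and on ]p, t[ the speed is at most C, so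
    [u i t - u i s <= u i t - u i p <= C (t - p)]. The bound from below is the
    same argument for [- u i], which is at least -1 ([increment_le_above]).

    It remains to pass from [v <= C], v being the weak derivative of a
    continuous scalar function u, to [u t - u s <= C (t - s)]
    ([increment_le]). Test with a
    smooth plateau phi that is 0 near s and t, climbs to 1 just after s and
    comes back down just before t. Then - int u phi' is close to u t - u s, as
    phi' consists of two bumps of mass 1 and -1 located near s and t, whereas
    int v phi <= C (t - s). Such plateaus are differences of two smooth steps,
    built in the usual way from the flat function exp (- 1 / x). *)

(** * Smooth functions of one variable *)

Section Smooth.
Context {R : realType}.
Implicit Types (f g : R -> R) (n k : nat) (x c : R).

(** Exhibiting the derivative, instead of asking that [derive1 f] be
    differentiable, makes closure under the ring operations an induction in
    which the derivative is the formula of the product or quotient rule. *)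
Fixpoint smoothn n f : Prop :=
  if n is n'.+1 then
    exists2 g, (forall x, is_derive x 1 f (g x)) & smoothn n' g
  else True.

Lemma smoothnW n f : smoothn n.+1 f -> smoothn n f.
Proof.
elim: n f => [//|n IH] f [g fg sg]; exists g => //; exact: IH.
Qed.

Lemma smoothn_derivable n f x : smoothn n.+1 f -> derivable (derive1n n f) x 1.
Proof.
elim: n f => [|n IH] f [g fg sg].
  by rewrite derive1n0; have [] := fg x.
have -> : derive1n n.+1 f = derive1n n g; last exact: IH.
by rewrite derive1Sn; congr derive1n; apply/funext => y; rewrite derive1E derive_val.
Qed.

Lemma smoothn_cst n c : smoothn n (cst c).
Proof.
elim: n c => [//|n IH] c; exists (cst 0) => // x; exact: is_derive_cst.
Qed.

Lemma smoothnD n f g : smoothn n f -> smoothn n g -> smoothn n (f \+ g).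
Proof.
elim: n f g => [//|n IH] f g [f' df sf] [g' dg sg].
by exists (f' \+ g'); [move=> x; exact: is_deriveD | exact: IH].
Qed.

Lemma smoothnM n f g : smoothn n f -> smoothn n g -> smoothn n (f \* g).
Proof.
elim: n f g => [//|n IH] f g sf sg.
have sf' := smoothnW sf; have sg' := smoothnW sg.
case: sf sg => [f' df sf] [g' dg sg].
exists ((f \* g') \+ (g \* f')); last by apply: smoothnD; exact: IH.
by move=> x; apply: is_deriveM.
Qed.

Lemma smoothnN n f : smoothn n f -> smoothn n (\- f).
Proof.
elim: n f => [//|n IH] f [f' df sf].
by exists (\- f'); [move=> x; exact: is_deriveN | exact: IH].
Qed.

Lemma smoothnV n f : (forall x, f x != 0) -> smoothn n f ->
  smoothn n (fun x => (f x)^-1).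
Proof.
move=> f0; elim: n => [//|n IH] sf.
have /IH sV := smoothnW sf.
case: sf => f' df sf.
exists ((\- f') \* ((fun x => (f x)^-1) \* (fun x => (f x)^-1))); last first.
  by apply: smoothnM; [exact: smoothnN | exact: smoothnM].
move=> x; apply: (is_derive_eq (is_deriveV (f0 x) (df x))).
by rewrite /GRing.scale /= expr2 invfM; ring.
Qed.

Lemma smoothn_affine n f (p c : R) : smoothn n f ->
  smoothn n (fun x => f (p * x + c)).
Proof.
elim: n f => [//|n IH] f [f' df sf].
exists (cst p \* (fun x => f' (p * x + c))); last first.
  by apply: smoothnM; [exact: smoothn_cst | exact: IH].
move=> x.
have da : is_derive x 1 (fun x => p * x + c) p.
  by apply: is_derive_eq; rewrite /GRing.scale /= !(mulr0,mulr1,addr0).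
rewrite /= mulrC.
exact: (@is_derive1_comp _ f (fun x => p * x + c) x _ _ (df _) da).
Qed.

(** The functions [x ^- k * exp (- 1 / x)], extended by 0 to the left of 0, are
    considered for all k together because their linear span is stable under
    differentiation. *)
Definition flat k x : R := if 0 < x then x^-1 ^+ k * expR (- x^-1) else 0.

Lemma flat_le0 k x : x <= 0 -> flat k x = 0.
Proof. by rewrite /flat leNgt => /negbTE ->. Qed.

Lemma flat_gt0 k x : 0 < x -> 0 < flat k x.
Proof. by move=> x0; rewrite /flat x0 mulr_gt0 ?expR_gt0 ?exprn_gt0 ?invr_gt0. Qed.

Lemma flat_ge0 k x : 0 <= flat k x.
Proof. by case: (ltP 0 x) => [/flat_gt0/ltW//|/flat_le0->]. Qed.

(** The exponential [exp (1 / x)] dominates its Taylor term of order [k + 2];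
    the quadratic bound gives differentiability at the origin, with derivative
    0. *)
Lemma flat_le_sqr k x : flat k x <= (k.+2)`!%:R * x ^+ 2.
Proof.
case: (ltP 0 x) => [x0|/flat_le0->]; last first.
  by rewrite mulr_ge0 // sqr_ge0.
rewrite /flat x0 expRN.
have y0 : 0 < x^-1 by rewrite invr_gt0.
have := expR_ge1Dxn k.+1 (ltW y0) => h.
rewrite ler_pdivrMr ?expR_gt0 //.
have F0 : (0:R) < (k.+2)`!%:R by rewrite ltr0n fact_gt0.
have -> : x^-1 ^+ k =
    (k.+2)`!%:R * x ^+ 2 * (x^-1 ^+ k.+2 / (k.+2)`!%:R).
  move: F0; rewrite !exprS; move: (k.+2)`!%:R (x^-1 ^+ k) => F y F0.
  by field; rewrite !gt_eqF.
apply: ler_wpM2l; first by rewrite mulr_ge0 ?sqr_ge0 // ltW.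
by apply: le_trans h; rewrite lerDr.
Qed.

Lemma is_derive_flat k x :
  is_derive x 1 (flat k) (- k%:R * flat k.+1 x + flat k.+2 x).
Proof.
have [x0|x0|->] := ltgtP x 0.
- rewrite !flat_le0 ?(ltW x0) // mulr0 addr0.
  apply: (@near_eq_is_derive _ _ _ (cst 0)) => //.
    near=> y; rewrite /= flat_le0 //; near: y.
    by apply: filterS (lt_nbhsl x0) => z /ltW.
- apply: (@near_eq_is_derive _ R^o R^o (fun y : R => y^-1 ^+ k * expR (- y^-1))).
    near=> y; rewrite /flat ifT //; near: y; exact: lt_nbhsr.
  have x0' := gt_eqF x0.
  have dV : is_derive x 1 (fun y : R => y^-1) (- x ^- 2).
    apply: (is_derive_eq (is_deriveV _ (is_derive_id x 1))).
      by rewrite x0'.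
    by rewrite /GRing.scale /= mulr1.
  have dE : is_derive x 1 (fun y => expR (- y^-1)) (expR (- x^-1) * x ^- 2).
    apply: (@is_derive1_comp _ expR (fun y => - y^-1)).
    by apply: (is_derive_eq (is_deriveN dV)); rewrite opprK.
  have := is_deriveX k dV; rewrite exprfctE => dX.
  apply: (is_derive_eq (is_deriveM dX dE)).
  rewrite /flat x0 /GRing.scale /= !exprS.
  case: k {dX} => [|k]; first by rewrite /= !expr0; field; rewrite x0'.
  by rewrite /= -mulr_natl !exprS; field; rewrite x0'.
- rewrite !flat_le0 // mulr0 addr0.
  (* the difference quotient at 0 is at most [(k.+2)`! * `|h|] *)
  have cv : h^-1 *: (flat k (h *: 1 + 0) - flat k 0) @[h --> 0^'] --> (0 : R).
    apply/cvgr0Pnorm_le => e e0.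
    have F0 : (0:R) < (k.+2)`!%:R by rewrite ltr0n fact_gt0.
    near=> h.
    have h0 : h != 0 by near: h; exact: nbhs_dnbhs_neq.
    have he : `|h| <= e / (k.+2)`!%:R.
      near: h; apply: cvg_within; apply: filterS; last first.
        exact: (@nbhs0_le _ R^o (e / (k.+2)`!%:R) (divr_gt0 e0 F0)).
      by [].
    rewrite [flat k 0]flat_le0 // subr0 /GRing.scale /= mulr1 addr0.
    rewrite normrM normfV (ger0_norm (flat_ge0 _ _)) mulrC.
    rewrite ler_pdivrMr ?normr_gt0 //.
    apply: (le_trans (flat_le_sqr _ _)).
    rewrite -real_normK ?num_real // expr2 mulrA.
    by apply: ler_wpM2r => //; rewrite mulrC -ler_pdivlMr.
  apply: DeriveDef; first by apply/cvg_ex; exists 0.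
  exact/cvg_lim.
Unshelve. all: by end_near.
Qed.


Lemma smoothn_flat n k : smoothn n (flat k).
Proof.
elim: n k => [//|n IH] k.
exists ((cst (- k%:R) \* flat k.+1) \+ flat k.+2).
  by move=> x; exact: is_derive_flat.
by apply: smoothnD => //; apply: smoothnM => //; exact: smoothn_cst.
Qed.
End Smooth.

(** * Smooth steps *)

Section Step.
Context {R : realType}.
Implicit Types (a b x : R) (n : nat).

Definition step a b x : R := flat 0 (x - a) / (flat 0 (x - a) + flat 0 (b - x)).

Lemma step_den_gt0 a b x : a < b -> 0 < flat 0 (x - a) + flat 0 (b - x).
Proof.
move=> ab; have [xa|xa] := ltP a x.
  by rewrite ltr_pwDl ?flat_ge0 // flat_gt0 // subr_gt0.
by rewrite ltr_wpDl ?flat_ge0 // flat_gt0 // subr_gt0 (le_lt_trans xa).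
Qed.

Lemma step_le a b x : x <= a -> step a b x = 0.
Proof. by move=> xa; rewrite /step flat_le0 ?mul0r // subr_le0. Qed.

Lemma step_ge a b x : a < b -> b <= x -> step a b x = 1.
Proof.
move=> ab bx; have := step_den_gt0 x ab; rewrite /step.
by rewrite (@flat_le0 _ 0 (b - x)) ?subr_le0 // addr0 => /gt_eqF/negbT/divff.
Qed.

Lemma step_itv01 a b x : a < b -> 0 <= step a b x <= 1.
Proof.
move=> ab; have d0 := step_den_gt0 x ab.
by rewrite divr_ge0 ?flat_ge0 ?(ltW d0) //= ler_pdivrMr // mul1r lerDl flat_ge0.
Qed.

Lemma smoothn_step n a b : a < b -> smoothn n (step a b).
Proof.
move=> ab.
have sa : smoothn n (fun x : R => flat 0 (x - a)).
  have := @smoothn_affine _ n (flat 0) 1 (- a) (smoothn_flat n 0).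
  by under eq_fun do rewrite mul1r.
have sb : smoothn n (fun x : R => flat 0 (b - x)).
  have := @smoothn_affine _ n (flat 0) (-1) b (smoothn_flat n 0).
  by under eq_fun do rewrite mulN1r addrC.
apply: (smoothnM sa); apply: smoothnV; last exact: smoothnD.
by move=> x; rewrite gt_eqF // step_den_gt0.
Qed.

Definition step_slope a b x : R :=
  (flat 2 (x - a) * flat 0 (b - x) + flat 0 (x - a) * flat 2 (b - x)) /
  (flat 0 (x - a) + flat 0 (b - x)) ^+ 2.

(** The sign and the support of the slope can be read off from the explicit
    formula. *)
Lemma is_derive_step a b x : a < b ->
  is_derive x 1 (step a b) (step_slope a b x).
Proof.
move=> ab.
have da : is_derive x 1 (fun x : R => flat 0 (x - a)) (flat 2 (x - a)).
  have d1 : is_derive x 1 (fun x : R => x - a) 1.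
    by apply: is_derive_eq; rewrite subr0.
  have := @is_derive1_comp _ (flat 0) _ x _ _ (is_derive_flat 0 (x - a)) d1.
  by rewrite oppr0 mul0r add0r mulr1.
have db : is_derive x 1 (fun x : R => flat 0 (b - x)) (- flat 2 (b - x)).
  have d1 : is_derive x 1 (fun x : R => b - x) (-1).
    by apply: is_derive_eq; rewrite add0r mul1r.
  have := @is_derive1_comp _ (flat 0) _ x _ _ (is_derive_flat 0 (b - x)) d1.
  by rewrite oppr0 mul0r add0r mulrN1.
have d0 := step_den_gt0 x ab.
have dV := @is_deriveV _ (fun x => flat 0 (x - a) + flat 0 (b - x)) x _ _
  (negbT (gt_eqF d0)) (is_deriveD da db).
apply: (is_derive_eq (is_deriveM da dV)).
rewrite /step_slope /GRing.scale /=.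
move: d0; move: (flat 0 _) (flat 0 _) (flat 2 _) (flat 2 _) => p q p' q' d0.
by field; rewrite gt_eqF.
Qed.

Lemma step_slope_ge0 a b x : 0 <= step_slope a b x.
Proof.
by rewrite divr_ge0 ?sqr_ge0 // addr_ge0 // mulr_ge0 ?flat_ge0.
Qed.

Lemma step_slope_out a b x : x <= a \/ b <= x -> step_slope a b x = 0.
Proof.
rewrite -subr_le0 -[b <= x]subr_le0 /step_slope.
by case=> h; rewrite !(flat_le0 _ h) !(mul0r, mulr0, addr0).
Qed.

End Step.

(** * Integrals of real functions on an interval *)

Section Integrals.
Context {R : realType}.
Local Notation mu := (@lebesgue_measure R).

Lemma integrable_boundedM (D : set R) (h f : R -> R) (M : R) : measurable D ->
  measurable_fun D h -> (forall x, D x -> `|h x| <= M) ->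
  mu.-integrable D (EFin \o f) -> mu.-integrable D (EFin \o (h \* f)).
Proof.
move=> mD mh hM fi.
have -> : EFin \o (h \* f) = ((EFin \o h) \* (EFin \o f))%E.
  by apply/funext => x /=; rewrite EFinM.
apply: integrableMr => //.
exists M; split; first by rewrite num_real.
by move=> y My x Dx /=; rewrite (le_trans (hM x Dx)) // ltW.
Qed.

(** The difference [g - f] agrees almost everywhere with its positive part. *)
Lemma ae_le_Rintegral (D : set R) (f g : R -> R) : measurable D ->
  mu.-integrable D (EFin \o f) -> mu.-integrable D (EFin \o g) ->
  {ae mu, forall x, D x -> f x <= g x} ->
  \int[mu]_(x in D) f x <= \int[mu]_(x in D) g x.
Proof.
move=> mD fi gi fg; rewrite -subr_ge0 -RintegralB //.
have mfg : measurable_fun D (g \- f).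
  by apply: measurable_realfun.measurable_funB; [case/integrableP: gi | case/integrableP: fi];
    move=> /measurable_realfun.measurable_EFinP.
have -> : \int[mu]_(x in D) (g x - f x) = \int[mu]_(x in D) Num.max (g x - f x) 0.
  congr fine; apply: ae_eq_integral => //.
  - exact/measurable_realfun.measurable_EFinP.
  - by apply/measurable_realfun.measurable_EFinP; apply: measurable_realfun.measurable_maxr.
  - move: fg; apply: filterS; first exact: (ae_filter_ringOfSetsType mu).
    move=> x fgx Dx.
    by rewrite max_l // subr_ge0 fgx.
by apply: Rintegral_ge0 => x _; rewrite le_max lexx orbT.
Qed.

Lemma smoothn_continuous n (f : R -> R) : smoothn n.+1 f -> continuous f.
Proof.
move=> [f' df _] x; apply: differentiable_continuous.
by apply/derivable1_diffP; have [] := df x.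
Qed.

Lemma continuous_integrable_itv (f : R -> R) (s t : R) : continuous f ->
  mu.-integrable `]s, t[ (EFin \o f).
Proof.
move=> cf.
have ic : mu.-integrable `[s, t] (EFin \o f).
  apply: continuous_compact_integrable; first exact: segment_compact.
  exact: continuous_subspaceT.
by apply: integrableS ic => //; exact: subset_itv_oo_cc.
Qed.

Lemma Rintegral_derivative (f f' : R -> R) (s t : R) : s < t ->
  (forall x : R, is_derive x 1 f (f' x)) -> continuous f' ->
  \int[mu]_(x in `]s, t[) f' x = f t - f s.
Proof.
move=> st df cf'.
have ifo := continuous_integrable_itv s t cf'.
have cf : continuous f.
  move=> x; apply: differentiable_continuous.
  by apply/derivable1_diffP; have [] := df x.
rewrite Rintegral_itv_obnd_cbnd // Rintegral_itv_bndo_bndc; last first.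
  have ic : mu.-integrable `[s, t] (EFin \o f').
    apply: continuous_compact_integrable; first exact: segment_compact.
    exact: continuous_subspaceT.
  by apply: integrableS ic => //; exact: subset_itv_co_cc.
rewrite /Rintegral (@continuous_FTC2 _ f' f) //.
- exact: continuous_subspaceT.
- split.
  + by move=> x _; have [] := df x.
  + exact/cvg_at_right_filter/cf.
  + exact/cvg_at_left_filter/cf.
- by move=> x _; rewrite derive1E derive_val.
Qed.

End Integrals.

(** * Increments under a one-sided bound on the weak derivative *)

Section WeakDerivative.
Context {R : realType}.
Local Notation mu := (@lebesgue_measure R).
Implicit Types (s t C : R) (w v f : R -> R).

Definition scalar_test s t f : Prop :=
  (forall n, smoothn n f) /\
  exists a b, [/\ s < a, b < t & forall x, ~~ (a <= x <= b) -> f x = 0].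

Definition scalar_weak_derivative s t w v : Prop := forall f, scalar_test s t f ->
  \int[mu]_(x in `]s, t[) (w x * derive1 f x) = - \int[mu]_(x in `]s, t[) (v x * f x).

(** Testing [- w] against f is testing w against [- f]. *)
Lemma scalar_weak_derivativeN s t w v : scalar_weak_derivative s t w v ->
  scalar_weak_derivative s t (\- w) (\- v).
Proof.
move=> wv f [sf [a [b [sa bt f0]]]].
have := wv (\- f); rewrite /scalar_test.
have -> : derive1 (\- f) = \- derive1 f.
  apply/funext => x; have [f' df _] := sf 1.
  have [_ E1] := df x; have [_ E2] := is_deriveN (df x).
  by rewrite /= !derive1E E1; exact: E2.
under eq_Rintegral do rewrite /= mulrN -mulNr.
under [X in _ = - X]eq_Rintegral do rewrite /= mulrN -mulNr.
apply; split=> [n|]; first exact: smoothnN.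
by exists a, b; split=> // x /f0 /= ->; rewrite oppr0.
Qed.

(** The test function is a plateau f that climbs on [s + d, s + 2d] and goes
    down on [t - 2d, t - d], where d is such that w is within e / 2 of [w s] and
    of [w t] on these intervals. Replacing w by these values on the two bumps of
    f' costs at most e, and [v * f <= C]. *)
Lemma increment_le s t C w v : s < t -> 0 <= C ->
  {within `[s, t], continuous w} -> mu.-integrable `]s, t[ (EFin \o v) ->
  scalar_weak_derivative s t w v -> {ae mu, forall x, x \in `]s, t[ -> v x <= C} ->
  w t - w s <= C * (t - s).
Proof.
move=> st C0 cw iv wv vC; apply/ler_addgt0Pr => e e0.
have e20 : 0 < e / 2 by rewrite divr_gt0.
have [_ /cvgrPdist_le/(_ _ e20)[d1 /= d10 ws] /cvgrPdist_le/(_ _ e20)[d2 /= d20 wt]] :=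
  (continuous_within_itvP w st).1 cw.
pose d : R := Num.min d1 (Num.min d2 (t - s)) / 5.
have dgt0 : 0 < d by rewrite divr_gt0 // !lt_min d10 d20 subr_gt0 st.
have [dd1 dd2 dts] : [/\ 5 * d <= d1, 5 * d <= d2 & 5 * d <= t - s].
  have -> : 5 * d = Num.min d1 (Num.min d2 (t - s)) by rewrite mulrC divfK.
  by rewrite !ge_min !lexx !orbT.
have lt1 : s + d < s + 2 * d by lra.
have lt2 : t - 2 * d < t - d by lra.
pose f1 := step (s + d) (s + 2 * d); pose f1' := step_slope (s + d) (s + 2 * d).
pose f2 := step (t - 2 * d) (t - d); pose f2' := step_slope (t - 2 * d) (t - d).
have df1 (x : R) : is_derive x 1 f1 (f1' x) by exact: is_derive_step.
have df2 (x : R) : is_derive x 1 f2 (f2' x) by exact: is_derive_step.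
have slope_cont (f f' : R -> R) : smoothn 2 f ->
    (forall x : R, is_derive x 1 f (f' x)) -> continuous f'.
  move=> [g dg sg] df'; suff -> : f' = g by exact: (@smoothn_continuous _ 0).
  by apply/funext => x; have [_ <-] := dg x; have [_ <-] := df' x.
have cf1' : continuous f1' by apply: slope_cont df1; exact: smoothn_step.
have cf2' : continuous f2' by apply: slope_cont df2; exact: smoothn_step.
pose f := f1 \- f2.
have sf n : smoothn n f.
  by apply: smoothnD; [|apply: smoothnN]; exact: smoothn_step.
have df (x : R) : is_derive x 1 f (f1' x - f2' x) by exact: is_deriveB.
have f01 x : 0 <= f x <= 1.
  have /andP[a1 b1] := step_itv01 x lt1; have /andP[a2 b2] := step_itv01 x lt2.
  rewrite /f /f1 /f2 /=; have [xt|xt] := leP x (t - 2 * d).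
    by rewrite (step_le _ xt); lra.
  by rewrite (@step_ge _ _ _ _ lt1); lra.
have testf : scalar_test s t f.
  split=> //; exists (s + d), (t - d); split; [lra|lra|] => x.
  rewrite negb_and -!ltNge => /orP[x_lt|x_gt].
    by rewrite /f /f1 /f2 /= !step_le ?subrr //; lra.
  by rewrite /f /f1 /f2 /= !step_ge ?subrr //; lra.
have vf : \int[mu]_(x in `]s, t[) (v x * f x) <= C * (t - s).
  have <- : \int[mu]_(x in `]s, t[) C = C * (t - s).
    rewrite Rintegral_cst //= lebesgue_measure_itv /= lte_fin st.
    by rewrite -EFinD.
  apply: ae_le_Rintegral => //.
  - have := @integrable_boundedM R `]s, t[ f v 1 _ _ _ iv.
    have -> : f \* v = (fun x => v x * f x) by apply/funext => x /=; rewrite mulrC.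
    apply => //.
      apply: measurable_funTS; apply: measurable_realfun.continuous_measurable_fun.
      exact: (@smoothn_continuous _ 0 _ (sf 1)).
    by move=> x _; have /andP[h1 h2] := f01 x; rewrite ger0_norm.
  - by apply: continuous_integrable_itv; exact: cst_continuous.
  - move: vC; apply: filterS; first exact: (ae_filter_ringOfSetsType mu).
    move=> x vC /vC vxC.
    have /andP[h1 h2] := f01 x.
    apply: (@le_trans _ _ (C * f x)); first exact: ler_wpM2r.
    by rewrite -[leRHS]mulr1 ler_wpM2l.
(* [g'] majorizes [w * f'] and has an explicit primitive *)
pose g := (cst (w s + e / 2) \* f1) \- (cst (w t - e / 2) \* f2).
pose g' := (cst (w s + e / 2) \* f1') \- (cst (w t - e / 2) \* f2').
have dg (x : R) : is_derive x 1 g (g' x).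
  rewrite /g /g' /=; apply: is_derive_eq.
  by rewrite /GRing.scale /= !mulr0 !addr0.
have cg' : continuous g'.
  move=> x; apply: cvgB; apply: cvgM; [exact: cvg_cst|exact: cf1'|exact: cvg_cst|exact: cf2'].
have ig := Rintegral_derivative st dg cg'.
have wf : \int[mu]_(x in `]s, t[) (w x * derive1 f x) <= g t - g s.
  rewrite -ig; apply: le_Rintegral => //.
  - have ic : mu.-integrable `[s, t] (EFin \o (fun x => w x * derive1 f x)).
      apply: continuous_compact_integrable; first exact: segment_compact.
      move=> x; apply: cvgM; first exact: cw.
      apply: continuous_subspaceT => y.
      have -> : derive1 f = f1' \- f2' by apply/funext => z; rewrite derive1E derive_val.
      by apply: cvgB; [exact: cf1'|exact: cf2'].
    by apply: integrableS ic => //; exact: subset_itv_oo_cc.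
  - exact: continuous_integrable_itv.
  - move=> x /=; rewrite in_itv /= => /andP[sx xt].
    rewrite derive1E derive_val /g' /= mulrBr; apply: lerB.
      have [x_in|x_out] := ltP x (s + 2 * d); last first.
        by rewrite /f1' step_slope_out ?mulr0 //; right.
      apply: ler_wpM2r; first exact: step_slope_ge0.
      have := ws x; rewrite /ball /= ltr_norml => /(_ _ sx).
      rewrite ler_norml => H.
      by have /andP[] : - (e / 2) <= w s - w x <= e / 2; [apply: H; lra | lra].
    have [x_in|x_out] := ltP (t - 2 * d) x; last first.
      by rewrite /f2' step_slope_out ?mulr0 //; left.
    apply: ler_wpM2r; first exact: step_slope_ge0.
    have := wt x; rewrite /ball /= ltr_norml => /(_ _ xt).
    rewrite ler_norml => H.
    by have /andP[] : - (e / 2) <= w t - w x <= e / 2; [apply: H; lra | lra].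
have gts : g t - g s = w s - w t + e.
  rewrite /g /f1 /f2 /= !(@step_ge _ _ _ t) ?(@step_le _ _ _ s) //; lra.
move: wf; rewrite wv // gts; lra.
Qed.

(** The speed of w has to be controlled only strictly above a lower bound m of
    w. If [w t = m] there is nothing to prove; otherwise the increment after
    the last time p at which w equals m is estimated with [increment_le], and
    before p the function does not gain anything, as [w p = m <= w s]. *)
Lemma increment_le_above s t C m w v : s <= t -> 0 <= C ->
  {within `[s, t], continuous w} -> (forall x, x \in `[s, t] -> m <= w x) ->
  (forall p, s <= p -> p < t ->
    mu.-integrable `]p, t[ (EFin \o v) /\ scalar_weak_derivative p t w v) ->
  {ae mu, forall x, x \in `]s, t[ -> m < w x -> v x <= C} ->
  w t - w s <= C * (t - s).
Proof.
move=> st C0 cw mw wv vC.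
have C0st : 0 <= C * (t - s) by rewrite mulr_ge0 // subr_ge0.
have ms : m <= w s by apply: mw; rewrite in_itv /= lexx.
have [stE|st_neq] := eqVneq s t; first by rewrite stE !subrr mulr0.
have {st st_neq} st : s < t by rewrite lt_neqAle st_neq.
have [wtm|wtm] := leP (w t) m; first by lra.
(* when w never touches m, p is the left end point s *)
have [p [sp pt wp above]] : exists p, [/\ s <= p, p < t, w p <= w s &
    forall x, x \in `]p, t[ -> m < w x].
  pose S := [set x | s <= x <= t /\ w x <= m].
  have [[x0 Sx0]|S0] := pselect (S !=set0); last first.
    exists s; split=> //.
    move=> x; rewrite in_itv /= => /andP[sx xt]; rewrite ltNge; apply/negP => wx.
    by apply: S0; exists x; split => //; rewrite !ltW.
  have Sub : has_sup S by split; [exists x0 | exists t => x [/andP[]]].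
  have Sle x : S x -> x <= sup S by move=> Sx; apply: sup_ubound => //; case: Sub.
  have sp : s <= sup S by apply: le_trans (Sle _ Sx0); case: Sx0 => /andP[].
  have pt : sup S <= t by apply: ge_sup => [|x [/andP[]]]; first exists x0.
  have wp : w (sup S) <= m.
    rewrite leNgt; apply/negP => wp.
    have pin : `[s, t]%classic (sup S) by rewrite /= in_itv /= sp pt.
    have wp0 : 0 < w (sup S) - m by rewrite subr_gt0.
    have /cvgrPdist_lt/(_ _ wp0)[d /= d0 dw] := (subspace_continuousP _ _).1 cw _ pin.
    have [x Sx xd] := sup_adherent d0 Sub.
    have := dw x; rewrite /ball /= => H; have xp := Sle _ Sx.
    case: Sx => sxt wx.
    have : `|w (sup S) - w x| < w (sup S) - m.
      by apply: H; [rewrite ger0_norm; lra | rewrite in_itv].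
    by rewrite ltr_norml => /andP[_]; lra.
  exists (sup S); split=> //.
  - rewrite lt_neqAle pt andbT; apply/eqP => pE.
    by move: wtm; rewrite -pE ltNge wp.
  - exact: le_trans ms.
  - move=> x; rewrite in_itv /= => /andP[px xt]; rewrite ltNge; apply/negP => wx.
    have : x <= sup S by apply: Sle; split => //; lra.
    lra.
have [iv wpv] := wv p sp pt.
have cwp : {within `[p, t], continuous w}.
  apply: continuous_subspaceW cw => x /=; rewrite !in_itv /= => /andP[px ->].
  by rewrite andbT (le_trans sp).
have vCp : {ae mu, forall x, x \in `]p, t[ -> v x <= C}.
  move: vC; apply: filterS; first exact: (ae_filter_ringOfSetsType mu).
    move=> x vCx xpt; apply: vCx; last exact: above.
  move: xpt; rewrite !in_itv /= => /andP[px ->].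
  by rewrite andbT (le_lt_trans sp).
have wpt := increment_le pt C0 cwp iv wpv vCp.
have : C * (t - p) <= C * (t - s) by rewrite ler_wpM2l // lerB.
lra.
Qed.

End WeakDerivative.

(** * Curves of vertex functions, component by component *)

Section GraphCurves.
Context {R : realType} {V : finType} (G : weighted_graph R V) (r : R).
Local Notation mu := (@lebesgue_measure R).
Implicit Types (i : V) (u v : R -> {ffun V -> R}).

Lemma degree_powR_gt0 i p : 0 < degree G i `^ p.
Proof. by rewrite powR_gt0 // /degree degree_gt0. Qed.

Lemma sqr_normV (x : {ffun V -> R}) : normV G r x ^+ 2 = innerV G r x x.
Proof.
rewrite /normV sqr_sqrtr // /innerV; apply: sumr_ge0 => i _.
by rewrite mulr_ge0 ?powR_ge0 // -expr2 sqr_ge0.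
Qed.

Lemma component_le_normV (x : {ffun V -> R}) i :
  (x i) ^+ 2 * degree G i `^ r <= normV G r x ^+ 2.
Proof.
rewrite sqr_normV /innerV (bigD1 i) //= -expr2 lerDl; apply: sumr_ge0 => j _.
by rewrite mulr_ge0 ?powR_ge0 // -expr2 sqr_ge0.
Qed.

Lemma normV_le (x : {ffun V -> R}) (c : V -> R) (z : R) :
  (forall i, `|x i| <= c i * z) -> 0 <= z ->
  normV G r x <= Num.sqrt (\sum_i c i ^+ 2 * degree G i `^ r) * z.
Proof.
move=> xc z0; rewrite -[z in leRHS]ger0_norm // -sqrtr_sqr -sqrtrM; last first.
  by apply: sumr_ge0 => i _; rewrite mulr_ge0 ?powR_ge0 ?sqr_ge0.
rewrite ler_wsqrtr // mulr_suml; apply: ler_sum => i _.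
rewrite [leRHS]mulrAC -exprMn; apply: ler_wpM2r; first exact: powR_ge0.
rewrite -expr2 -real_normK ?num_real // lerXn2r ?nnegrE //.
exact: le_trans (xc i).
Qed.

Lemma continuousV_component (T : interval R) u i : Defs.continuousV G r T u ->
  {within [set` T], continuous (fun t => u t i)}.
Proof.
move=> cu; apply/subspace_continuousP => t Tt; apply/cvgrPdist_le => e e0.
have k0 := degree_powR_gt0 i r.
have sk0 : 0 < Num.sqrt (degree G i `^ r) by rewrite sqrtr_gt0.
have /cvgr0Pnorm_le /(_ _ (mulr_gt0 e0 sk0)) := cu t Tt.
apply: filterS => s.
rewrite ger0_norm ?sqrtr_ge0 // => h.
rewrite -(ler_pM2r sk0); apply: le_trans h.
rewrite -ler_sqr ?nnegrE ?mulr_ge0 ?sqrtr_ge0 //.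
rewrite exprMn sqr_sqrtr ?(ltW k0) // distrC real_normK ?num_real //.
by have := component_le_normV (u s - u t) i; rewrite !ffunE.
Qed.

(** The interval is bounded, so that [`|y| <= 1 + y ^+ 2] reduces integrability
    to square integrability. *)
Lemma L2_component_integrable (s t : R) v i : L2 G r `]s, t[ v ->
  mu.-integrable `]s, t[ (EFin \o (fun x => v x i)).
Proof.
move=> [mv iv].
have k0 := degree_powR_gt0 i r; set k := degree G i `^ r in k0.
have mn : measurable_fun `]s, t[%classic (fun x => normV G r (v x) ^+ 2).
  have -> : (fun x => normV G r (v x) ^+ 2) =
      (fun x => \sum_j v x j * v x j * degree G j `^ r).
    by apply/funext => x; rewrite sqr_normV.
  apply: measurable_fun_approximation.measurable_sum => j.
  apply: measurable_realfun.measurable_funM => //.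
  exact: measurable_realfun.measurable_funM.
have in2 : mu.-integrable `]s, t[ (EFin \o (fun x => normV G r (v x) ^+ 2)).
  apply/integrableP; split; first exact/measurable_realfun.measurable_EFinP.
  by under eq_integral do rewrite /= ger0_norm ?sqr_ge0 //.
have ib : mu.-integrable `]s, t[
    ((EFin \o cst 1%R) \+ (fun x => (k^-1)%R%:E * ((normV G r (v x) ^+ 2)%R)%:E))%E.
  apply: integrableD => //.
    by apply: continuous_integrable_itv; exact: cst_continuous.
  exact: integrableZl.
apply: le_integrable ib => //.
  by apply/measurable_realfun.measurable_EFinP; exact: mv.
move=> x _; rewrite /= lee_fin.
rewrite [leRHS]ger0_norm; last first.
  by rewrite addr_ge0 // mulr_ge0 ?invr_ge0 ?sqr_ge0 // ltW.
have : (v x i) ^+ 2 <= k^-1 * normV G r (v x) ^+ 2.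
  by rewrite mulrC ler_pdivlMr //; exact: component_le_normV.
have := sqr_ge0 (`|v x i| - 1).
rewrite sqrrB1 real_normK ?num_real //; have := normr_ge0 (v x i); lra.
Qed.

(** Test with f placed at the vertex i and divided by the weight that the inner
    product gives to i. *)
Lemma weak_derivative_component (s t : R) u v i :
  weak_derivative G r `]s, t[ u v ->
  scalar_weak_derivative s t (fun x => u x i) (fun x => v x i).
Proof.
move=> uv f [sf [a [b [sa bt f0]]]].
pose k := degree G i `^ r.
have k0 : k != 0 by rewrite gt_eqF // degree_powR_gt0.
pose phi x : {ffun V -> R} := [ffun j => if j == i then k^-1 * f x else 0].
have phiE j : (fun x => phi x j) = if j == i then cst k^-1 \* f else cst 0.
  by apply/funext => x; rewrite ffunE; case: ifP.
have innerE (y : {ffun V -> R}) (z : {ffun V -> R}) c :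
    z = [ffun j => if j == i then k^-1 * c else 0] -> innerV G r y z = y i * c.
  move=> ->; rewrite /innerV (bigD1 i) //= big1 ?addr0 => [|j ji].
    by rewrite ffunE eqxx mulrA mulrAC mulrAC -/k; field.
  by rewrite ffunE (negbTE ji) mulr0 mul0r.
have df x : derivable f x 1 by have [f' df _] := sf 1; have [] := df x.
have := uv phi; rewrite /test_function.
under eq_Rintegral => x _.
  rewrite (innerE _ _ (derive1 f x)); last first.
    apply/ffunP => j; rewrite !ffunE phiE; case: ifP => _; last exact: derive1_cst.
    by rewrite derive1Ml //.
  over.
under [X in _ = - X]eq_Rintegral => x _ do rewrite (innerE _ _ (f x)) //.
apply; split.
  move=> n j x; rewrite phiE; apply: smoothn_derivable.
  case: ifP => _; last exact: smoothn_cst.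
  by apply: smoothnM => //; exact: smoothn_cst.
exists `[a, b]%classic.
  split; first exact: segment_compact.
  move=> x /=; rewrite !in_itv /=; lra.
move=> x /= /negP; rewrite in_itv /= => /f0 fx0.
by apply/ffunP => j; rewrite !ffunE fx0 mulr0 if_same.
Qed.

Lemma laplacian_bound (x : {ffun V -> R}) i : valued_in `[0, 1] x ->
  `|laplacian G r x i| <= degree G i `^ (- r) * degree G i.
Proof.
move=> x01; rewrite ffunE normrM ger0_norm ?powR_ge0 //.
apply: ler_wpM2l; first exact: powR_ge0.
apply: le_trans (ler_norm_sum _ _ _) _; apply: ler_sum => j _.
have wij : 0 <= weight G i j.
  by have [/weight_gt0/ltW//|/weight_eq0->] := boolP (edge G i j).
rewrite normrM ger0_norm // -[leRHS]mulr1; apply: ler_wpM2l => //.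
have := x01 i; have := x01 j; rewrite /= !in_itv /= ler_norml; lra.
Qed.

Definition speed_bound (eps : R) i : R :=
  degree G i `^ (- r) * degree G i + (2 * eps)^-1.

Lemma speed_bound_ge0 eps i : 0 < eps -> 0 <= speed_bound eps i.
Proof.
move=> e0; rewrite addr_ge0 //; last by rewrite invr_ge0 mulr_ge0 // ltW.
by rewrite mulr_ge0 ?powR_ge0 // /degree ltW // degree_gt0.
Qed.

(** Where [x i > 0] the multiplier pushes downwards or vanishes, and where
    [x i < 1] it pushes upwards or vanishes. The remaining terms are bounded:
    the Laplacian by [laplacian_bound], and [x i - 1 / 2] by 1 / 2. *)
Lemma obstacle_speed (eps : R) (x dx b : {ffun V -> R}) i : 0 < eps ->
  valued_in `[0, 1] x ->
  eps *: dx + eps *: laplacian G r x + 2^-1 *: oneV - x = b ->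
  obstacle_subdiff x b ->
  (0 < x i -> dx i <= speed_bound eps i) /\
  (x i < 1 -> - speed_bound eps i <= dx i).
Proof.
move=> e0 x01 /(congr1 (fun h : {ffun V -> R} => h i)) E ob.
have := laplacian_bound i x01; move: E (ob i) (x01 i).
rewrite !ffunE /GRing.scale /= in_itv /= ler_norml /speed_bound.
set L := degree G i `^ _ * \sum_ _ _; set D := _ * degree G i.
move=> E [ob0 obI ob1] /andP[x0 x1] /andP[L1 L2].
have i2 : eps * (2 * eps)^-1 = 2^-1 by field; rewrite gt_eqF.
have eL1 : eps * - D <= eps * L by rewrite ler_pM2l.
have eL2 : eps * L <= eps * D by rewrite ler_pM2l.
split=> xi.
  have b_le0 : b i <= 0.
    have [x1'|x1'] := ltP (x i) 1; first by rewrite obI // xi.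
    by apply: ob1; apply/eqP; rewrite eq_le x1.
  by rewrite -(ler_pM2l e0) mulrDr i2; lra.
have b_ge0 : 0 <= b i.
  have [x0'|x0'] := ltP 0 (x i); first by rewrite obI // x0'.
  by apply: ob0; apply/eqP; rewrite eq_le x0'.
by rewrite -(ler_pM2l e0) mulrN mulrDr i2; lra.
Qed.

(** [increment_le_above] is applied to [u i], which is at least 0, and to
    [- u i], which is at least -1. *)
Lemma solution_component_increment (eps : R) u beta (s t : R) i : 0 < eps ->
  double_obstacle_AC_solution G r eps `[0, +oo[ u beta -> 0 <= s -> s <= t ->
  `|u s i - u t i| <= speed_bound eps i * (t - s).
Proof.
move=> e0 [u01 _ cu [du wdu ae_eq]] s0 st.
have B0 := speed_bound_ge0 i e0.
have cw : {within `[s, t], continuous (fun x => u x i)}.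
  have cu0 := continuousV_component (i := i) cu.
  apply: (continuous_subspaceW _ cu0) => x /=.
  by rewrite !in_itv /= andbT => /andP[/(le_trans s0)].
have wd p : s <= p -> p < t -> mu.-integrable `]p, t[ (EFin \o (fun x => du x i)) /\
    scalar_weak_derivative p t (fun x => u x i) (fun x => du x i).
  move=> sp pt; have p0 := le_trans s0 sp.
  have [] := wdu p t; rewrite ?in_itv /= ?andbT ?p0 ?(le_trans s0 st) //.
  by move=> /(L2_component_integrable i) iv /(weak_derivative_component i).
have ui x : x \in `[s, t] -> 0 <= u x i <= 1.
  rewrite in_itv /= => /andP[sx _].
  by have := u01 x _ i; rewrite !in_itv /= andbT (le_trans s0 sx) => /(_ isT).
have speed : {ae mu, forall x, x \in `]s, t[ ->
    (0 < u x i -> du x i <= speed_bound eps i) /\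
    (u x i < 1 -> - speed_bound eps i <= du x i)}.
  move: ae_eq; apply: filterS; first exact: (ae_filter_ringOfSetsType mu).
  move=> x xeq; rewrite in_itv /= => /andP[sx _].
  have x0 : x \in `[0, +oo[ by rewrite in_itv /= andbT (le_trans s0) // ltW.
  have [] := xeq x0; apply: obstacle_speed => //; exact: u01.
have up : u t i - u s i <= speed_bound eps i * (t - s).
  apply: (@increment_le_above _ s t _ 0 (fun x => u x i) (fun x => du x i)) => //.
    by move=> x /ui/andP[].
  move: speed; apply: filterS; first exact: (ae_filter_ringOfSetsType mu).
  by move=> x xs /xs[].
have down : - u t i - - u s i <= speed_bound eps i * (t - s).
  apply: (@increment_le_above _ s t _ (-1) (fun x => - u x i) (fun x => - du x i)) => //.
  - by move=> x; apply: cvgN; exact: cw.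
  - by move=> x /ui/andP[_]; rewrite lerN2.
  - move=> p sp pt; have [iv wv] := wd p sp pt; split; last exact: scalar_weak_derivativeN.
    exact: (integrableN iv).
  - move: speed; apply: filterS; first exact: (ae_filter_ringOfSetsType mu).
    by move=> x xs /xs[_]; rewrite ltrN2 => h /h; rewrite lerNl.
by rewrite ler_norml; lra.
Qed.

End GraphCurves.

(** * The Lipschitz bound *)

Theorem theorem3p10 (R : realType) (V : finType) (G : weighted_graph R V)
    (r eps : R) (hr : 0 <= r <= 1) (heps : 0 < eps)
    (u beta : R -> {ffun V -> R})
    (hsol : double_obstacle_AC_solution G r eps `[0, +oo[ u beta) :
  lipschitzV G r `[0, +oo[ u.
Proof.
exists (Num.sqrt (\sum_i speed_bound G r eps i ^+ 2 * degree G i `^ r)) => s t.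
rewrite !in_itv /= !andbT => s0 t0.
apply: normV_le => // i; rewrite !ffunE.
have [st|/ltW ts] := leP s t.
  by rewrite [`|s - t|]distrC (ger0_norm (_ : 0 <= t - s)) ?subr_ge0 //
    (solution_component_increment _ heps hsol).
by rewrite [leLHS]distrC (ger0_norm (_ : 0 <= s - t)) ?subr_ge0 //
    (solution_component_increment _ heps hsol).
Qed.
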